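(* Let $(S,d)$ be an asymmetric $k$-center instance with optimal radius $r^*$ and optimal clustering $\{C_1,\dots,C_k\}$, let $\alpha\ge1$, and let $\mathcal{C}$ be the clustering induced by a set of $k$ centers whose $k$-center cost is at most $\alpha r^*$. Then every optimal cluster that is $\alpha$-locally perturbation resilient is a cluster of $\mathcal{C}$; moreover this holds even for every optimal cluster that merely satisfies $\alpha$-local metric perturbation resilience.
   Context: An asymmetric $k$-center instance is a finite set $S$ with $d:S\times S\to\mathbb{R}_{\ge0}$ satisfying the metric axioms except symmetry (in particular the directed triangle inequality $d(u,w)\le d(u,v)+d(v,w)$); this includes ordinary symmetric $k$-center. For $X\subseteq S$ with $|X|=k$, the cost is $\max_{v\in S}\min_{x\in X}d(x,v)$, $r^*$ is the minimum cost, and the clustering induced by $X$ assigns each $v$ to the center $x\in X$ minimizing $d(x,v)$. For $\alpha\ge1$, an $\alpha$-perturbation of $d$ is any $d'$ with $d(u,v)\le d'(u,v)\le\alpha d(u,v)$ for all $u,v$; it is an $\alpha$-metric perturbation if in addition $d'$ satisfies the (directed) triangle inequality. An optimal cluster $C_i$ is $\alpha$-locally perturbation resilient (resp. $\alpha$-locally metric perturbation resilient) if for every $\alpha$-perturbation (resp. every $\alpha$-metric perturbation) $d'$, the optimal $k$-center clustering under $d'$ contains $C_i$ as one of its clusters. *)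

(* Defs.v *)
From mathcomp Require Import all_boot all_order all_algebra.
From mathcomp Require Import reals.

Set Implicit Arguments.
Unset Strict Implicit.
Unset Printing Implicit Defensive.

Import Order.TTheory GRing.Theory Num.Theory.
Local Open Scope ring_scope.

Section AsymmetricKCenter.
Variables (R : realType) (S : finType).
Implicit Types (d : S -> S -> R) (X A : {set S}) (P : {set {set S}}).

Definition triangle_ineq d := forall u v w, d u w <= d u v + d v w.

Record asymmetric_metric d : Prop := AsymmetricMetric {
  asym_ge0 : forall u v, 0 <= d u v;
  asym_eq0 : forall u v, d u v = 0 <-> u = v;
  asym_triangle : triangle_ineq d }.

(* The default value of the minimum bounds every [d x v] from above, so it    *)
(* plays no role as soon as [X] is nonempty; see [dist_from_attained].        *)
Definition dist_from d X (v : S) : R :=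
  \big[Num.min / \big[Num.max/0]_(u : S) d u v]_(x in X) d x v.

(* The distance functions considered are nonnegative, hence the default 0. *)
Definition cost d X : R := \big[Num.max/0]_(v : S) dist_from d X v.

Definition optimal_centers d (k : nat) X :=
  #|X| = k /\ forall Y : {set S}, #|Y| = k -> cost d X <= cost d Y.

Definition optimal_radius d (k : nat) (r : R) :=
  exists2 X, optimal_centers d k X & cost d X = r.

(* A center set may induce several clusterings, as ties between equally close *)
(* centers may be broken arbitrarily: [f] maps each point to its center.      *)
Definition nearest_center d X (f : S -> S) :=
  forall v, f v \in X /\ forall x, x \in X -> d (f v) v <= d x v.

Definition induced_clustering d X P :=
  exists2 f, nearest_center d X f & P = [set [set v | f v == x] | x in X].

Definition optimal_clustering d (k : nat) P :=
  exists2 X, optimal_centers d k X & induced_clustering d X P.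

Definition perturbation (alpha : R) d (d' : S -> S -> R) :=
  forall u v, d u v <= d' u v <= alpha * d u v.

Definition metric_perturbation (alpha : R) d (d' : S -> S -> R) :=
  perturbation alpha d d' /\ triangle_ineq d'.

(* When the optimal clustering under [d'] is not unique, every one of them is *)
(* required to contain the cluster.                                           *)
Definition locally_resilient (alpha : R) d (k : nat) A :=
  forall d', perturbation alpha d d' ->
  forall P, optimal_clustering d' k P -> A \in P.

Definition locally_metric_resilient (alpha : R) d (k : nat) A :=
  forall d', metric_perturbation alpha d d' ->
  forall P, optimal_clustering d' k P -> A \in P.

Lemma dist_from_attained d X v : X != set0 ->
  exists2 x, x \in X &
    dist_from d X v = d x v /\ forall y, y \in X -> d x v <= d y v.
Proof.
case/set0Pn => x0 x0X; case: (arg_minP (fun x => d x v) x0X) => x xX xmin.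
exists x => //; split => //; apply/le_anti/andP; split.
  exact: bigmin_le_cond.
by apply/bigmin_geP; split=> [|y /xmin//]; apply: le_bigmax.
Qed.

End AsymmetricKCenter.

(* Main.v *)
(** Perturb [d] into [d' := g \o d], where [g t = max t (min (alpha t) (alpha r))]
    and [r] is the optimal radius.  The profile [g] is nondecreasing and
    subadditive, so [d'] is an [alpha]-metric perturbation of [d], nearest
    centers for [d] remain nearest for [d'], and the [d']-cost of a center set
    is the image of its [d]-cost by [g].  Since [g] is constant on
    [[r, alpha r]], every center set of [d]-cost at most [alpha r] is optimal
    for [d'], so its clustering contains each locally resilient cluster. *)
Require Import Defs.
From mathcomp Require Import all_boot all_order all_algebra.
From mathcomp Require Import reals.

Import Order.TTheory GRing.Theory Num.Theory.
Local Open Scope ring_scope.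

Section MonotoneTransform.
Variables (R : realType) (S : finType) (d : S -> S -> R) (g : R -> R).
Hypothesis g_homo : {homo g : x y / x <= y}.

Let gd u v := g (d u v).

Lemma homo_max : {morph g : x y / Num.max x y}.
Proof.
move=> x y; case: (leP x y) => [xy|/ltW yx].
  by rewrite max_r // g_homo.
by rewrite max_l // g_homo.
Qed.

Lemma homo_min : {morph g : x y / Num.min x y}.
Proof.
move=> x y; case: (leP x y) => [xy|/ltW yx].
  by rewrite min_l // g_homo.
by rewrite min_r // g_homo.
Qed.

(** The default of the minimum is itself a maximum of distances starting from 0, so [g] carries it
    along once [g 0 = 0]; an empty [X] needs no separate case. *)
Lemma dist_from_homo X v : g 0 = 0 -> dist_from gd X v = g (dist_from d X v).
Proof.
move=> g0; rewrite /dist_from (big_morph g homo_min erefl).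
by rewrite (big_morph g homo_max g0).
Qed.

Lemma cost_homo X : g 0 = 0 -> cost gd X = g (cost d X).
Proof.
move=> g0; rewrite /cost (big_morph g homo_max g0).
by apply: eq_bigr => v _; rewrite dist_from_homo.
Qed.

Lemma nearest_center_homo X f : nearest_center d X f -> nearest_center gd X f.
Proof.
by move=> near v; have [fvX fmin] := near v; split=> // x /fmin; apply: g_homo.
Qed.

End MonotoneTransform.

Section Plateau.
Variables (R : realType) (alpha r : R).
Hypotheses (alpha_ge1 : 1 <= alpha) (r_ge0 : 0 <= r).

(** On nonnegative [t]: slope [alpha] up to [r], flat up to [alpha * r], then the identity. *)
Definition plateau (t : R) : R := Num.max t (Num.min (alpha * t) (alpha * r)).

Let alpha_ge0 : 0 <= alpha := le_trans ler01 alpha_ge1.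

Lemma plateau_homo : {homo plateau : x y / x <= y}.
Proof.
move=> x y xy; rewrite /plateau.
have axy : alpha * x <= alpha * y by rewrite ler_wpM2l.
by rewrite ge_max !le_max xy /= le_min !ge_min axy lexx !orbT.
Qed.

Lemma plateau0 : plateau 0 = 0.
Proof. by rewrite /plateau mulr0 min_l ?maxxx // mulr_ge0. Qed.

Lemma plateau_radius : plateau r = alpha * r.
Proof. by rewrite /plateau minxx max_r // ler_peMl. Qed.

Lemma plateau_alpha_radius : plateau (alpha * r) = alpha * r.
Proof. by rewrite /plateau max_l // ge_min lexx orbT. Qed.

Lemma plateau_bounds t : 0 <= t -> t <= plateau t <= alpha * t.
Proof.
by move=> t0; rewrite /plateau le_max lexx ge_max ge_min lexx ler_peMl.
Qed.

(** The identity and the truncated linear map are both subadditive on nonnegative reals, and a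
    maximum of subadditive functions is subadditive. *)
Lemma plateau_subadditive x y :
  0 <= x -> 0 <= y -> plateau (x + y) <= plateau x + plateau y.
Proof.
move=> x0 y0; rewrite /plateau.
have ax0 : 0 <= alpha * x by rewrite mulr_ge0.
have ay0 : 0 <= alpha * y by rewrite mulr_ge0.
have ar0 : 0 <= alpha * r by rewrite mulr_ge0.
rewrite ge_max; apply/andP; split; first by rewrite lerD // le_max lexx.
apply: (@le_trans _ _ (Num.min (alpha * x) (alpha * r)
                       + Num.min (alpha * y) (alpha * r))); last first.
  by rewrite lerD // le_max lexx orbT.
rewrite mulrDr ge_min.
(* If either summand is truncated, it alone reaches [alpha * r]; otherwise the sum is exactly
   [alpha * x + alpha * y]. *)
by case: (leP (alpha * x)) => _; case: (leP (alpha * y)) => _;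
  rewrite ?lexx // ?lerDl ?lerDr ?ax0 ?ay0 ?ar0 orbT.
Qed.

End Plateau.

Lemma cost_ge0 (R : realType) (S : finType) (d : S -> S -> R) X : 0 <= cost d X.
Proof. exact: bigmax_ge_id. Qed.

Lemma approx_clustering_optimal (R : realType) (S : finType) (d : S -> S -> R)
    (k : nat) (r alpha : R) (X : {set S}) (C : {set {set S}}) :
  asymmetric_metric d -> optimal_radius d k r -> 1 <= alpha ->
  #|X| = k -> cost d X <= alpha * r -> induced_clustering d X C ->
  exists2 d', metric_perturbation alpha d d' & optimal_clustering d' k C.
Proof.
move=> [d_ge0 _ d_tri] [X0 [_ X0min] X0r] alpha1 Xk Xcost [f fnear ->].
have r0 : 0 <= r by rewrite -X0r cost_ge0.
have g_homo := plateau_homo R alpha r alpha1.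
have g0 := plateau0 R alpha r alpha1 r0.
exists (fun u v => plateau R alpha r (d u v)); first split.
- by move=> u v; apply: plateau_bounds.
- move=> u v w; apply: le_trans (plateau_subadditive _ _ _ _ _ _ _ _ _) => //.
  exact: g_homo.
exists X; last by exists f => //; apply: nearest_center_homo.
split=> // Y Yk; rewrite !cost_homo //.
(* The plateau value separates the two costs: [X] costs at most [alpha * r] under [d'], while [Y]
   has [d]-cost at least [r], hence [d']-cost at least [alpha * r]. *)
apply: (@le_trans _ _ (alpha * r)).
  by rewrite -[leRHS](plateau_alpha_radius R alpha r); apply: g_homo.
by rewrite -[leLHS]plateau_radius //; apply: g_homo; rewrite -X0r X0min.
Qed.

Theorem theorem2 (R : realType) (S : finType) (d : S -> S -> R) (k : nat)
    (hd : asymmetric_metric d) (hk : (0 < k)%N)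
    (rstar : R) (hr : optimal_radius d k rstar)
    (Copt : {set {set S}}) (hCopt : optimal_clustering d k Copt)
    (alpha : R) (halpha : 1 <= alpha)
    (X : {set S}) (hXk : #|X| = k) (hX : cost d X <= alpha * rstar)
    (C : {set {set S}}) (hC : induced_clustering d X C) :
  (forall A : {set S}, A \in Copt -> locally_resilient alpha d k A -> A \in C)
  /\
  (forall A : {set S}, A \in Copt ->
     locally_metric_resilient alpha d k A -> A \in C).
Proof.
(* This [d'] does not depend on the cluster and is metric, so it serves both kinds of resilience. *)
have [d' dd' C_opt] := approx_clustering_optimal _ _ _ _ _ _ _ _
  hd hr halpha hXk hX hC.
by split=> A _ resA; apply: (resA d') => //; case: dd'.
Qed.
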